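(* Given a simple $\mathrm{Cu}$-semigroup $S$, every sub-$\mathrm{Cu}$-semigroup of $S$ is simple. Given a weakly cancellative $\mathrm{Cu}$-semigroup $S$, every sub-$\mathrm{Cu}$-semigroup of $S$ is weakly cancellative. In particular, simplicity and weak cancellation each satisfy the L\''owenheim-Skolem condition.
   Context: Way-below relation: in a partially ordered set, $x\ll y$ means that for every increasing sequence $(z_n)_n$ that has a supremum $z$ with $y\leq z$ there exists $n$ with $x\leq z_n$. A $\mathrm{Cu}$-semigroup is an abelian monoid $S$ with a partial order such that $0\leq x$ for all $x$, and $x\leq y$ implies $x+z\leq y+z$, satisfying: (O1) every increasing sequence has a supremum; (O2) every element is the supremum of a $\ll$-increasing sequence (i.e. $x_n\ll x_{n+1}$ for all $n$); (O3) $x'\ll x$ and $y'\ll y$ imply $x'+y'\ll x+y$; (O4) $\sup_n x_n+\sup_n y_n=\sup_n(x_n+y_n)$ for increasing sequences $(x_n)_n,(y_n)_n$. A $\mathrm{Cu}$-morphism is an order-preserving monoid morphism between $\mathrm{Cu}$-semigroups that preserves suprema of increasing sequences and the way-below relation. A submonoid $T\subseteq S$ is a sub-$\mathrm{Cu}$-semigroup if $T$ is a $\mathrm{Cu}$-semigroup with respect to the order induced by $S$ and the inclusion map $T\to S$ is a $\mathrm{Cu}$-morphism. A subset $B\subseteq S$ is a basis if for all $x'\ll x$ in $S$ there exists $y\in B$ with $x'\ll y\ll x$; $S$ is countably based if it has a countable basis. Simple: for all $x,y\in S$ with $y\neq0$ we have $x\leq\infty y$, where $\infty y:=\sup_n ny$.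 Weakly cancellative: $x+z\ll y+z$ implies $x\ll y$. $\mathrm{Sub}_{\mathrm{ctbl}}(S)$ is the collection of countably based sub-$\mathrm{Cu}$-semigroups of $S$. For a subset $T\subseteq S$, its sup-closure $\overline{T}^{\mathrm{sup}}$ is the smallest subset of $S$ that contains $T$ and is closed under suprema of increasing sequences. If $\mathcal{T}\subseteq\mathrm{Sub}_{\mathrm{ctbl}}(S)$ is countable and (upward) directed, then $\overline{\bigcup\mathcal{T}}^{\mathrm{sup}}\in\mathrm{Sub}_{\mathrm{ctbl}}(S)$. A collection $\mathcal{R}\subseteq\mathrm{Sub}_{\mathrm{ctbl}}(S)$ is $\sigma$-complete if $\overline{\bigcup\mathcal{T}}^{\mathrm{sup}}\in\mathcal{R}$ for every countable, directed subset $\mathcal{T}\subseteq\mathcal{R}$; it is cofinal if for every $T_0\in\mathrm{Sub}_{\mathrm{ctbl}}(S)$ there is $T\in\mathcal{R}$ with $T_0\subseteq T$. A property $\mathcal{P}$ of $\mathrm{Cu}$-semigroups satisfies the L\''owenheim-Skolem condition if for every $\mathrm{Cu}$-semigroup $S$ satisfying $\mathcal{P}$ there exists a $\sigma$-complete, cofinal subcollection $\mathcal{R}\subseteq\mathrm{Sub}_{\mathrm{ctbl}}(S)$ such that every $R\in\mathcal{R}$ satisfies $\mathcal{P}$. *)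

(* Defs.v *)
From HB Require Import structures.
From mathcomp Require Import all_boot all_order all_algebra.
From mathcomp Require Import boolp classical_sets cardinality.

Set Implicit Arguments.
Unset Strict Implicit.
Unset Printing Implicit Defensive.

Import Order.TTheory GRing.Theory.

Local Open Scope classical_set_scope.
Local Open Scope ring_scope.
Local Open Scope order_scope.

Section Poset.
Context {d : Order.disp_t} {P : porderType d}.
Implicit Types (x y z : P) (u : nat -> P) (T : set P).

Definition increasing u : Prop := {homo u : m n / (m <= n)%N >-> m <= n}.

Definition is_seq_sup u z : Prop := supremums (range u) z.

Definition way_below x y : Prop :=
  forall u z, increasing u -> is_seq_sup u z -> y <= z -> exists n, x <= u n.

Definition sup_closed T : Prop :=
  forall u z, increasing u -> is_seq_sup u z -> (forall n, T (u n)) -> T z.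

Definition sup_closure T : set P := smallest sup_closed T.

Definition is_basis (B : set P) : Prop :=
  forall x' x, way_below x' x -> exists2 y, B y & way_below x' y /\ way_below y x.

Definition countably_based : Prop :=
  exists B : set P, countable B /\ is_basis B.

End Poset.

Arguments countably_based {d} P.

(* Abelian monoids with a partial order; no compatibility is imposed yet.  This is
   a record on top of nmodType rather than a Hierarchy-Builder join with porderType
   because Hierarchy-Builder rejects such a join once Num.POrderedZmodule exists. *)
Record poMonoid : Type := PoMonoid {
  pom_nmod : nmodType;
  pom_le : rel pom_nmod;
  pom_le_refl : reflexive pom_le;
  pom_le_anti : antisymmetric pom_le;
  pom_le_trans : transitive pom_le
}.

Definition pom_type (S : poMonoid) : Type := pom_nmod S.
Coercion pom_type : poMonoid >-> Sortclass.

HB.instance Definition _ (S : poMonoid) :=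
  GRing.Nmodule.copy (pom_type S) (pom_nmod S).
HB.instance Definition _ (S : poMonoid) :=
  Order.Le_isPOrder.Build (Order.Disp tt tt) (pom_type S)
    (@pom_le_refl S) (@pom_le_anti S) (@pom_le_trans S).

Record cu_axioms (S : poMonoid) : Prop := CuAxioms {
  cu_ge0 : forall x : S, (0%R : S) <= x;
  cu_leD2r : forall x y z : S, x <= y -> (x + z : S) <= y + z;
  cu_O1 : forall u : nat -> S, increasing u -> exists z, is_seq_sup u z;
  cu_O2 : forall x : S, exists u : nat -> S,
    (forall n, way_below (u n) (u n.+1)) /\ is_seq_sup u x;
  cu_O3 : forall x' x y' y : S,
    way_below x' x -> way_below y' y -> way_below (x' + y') (x + y);
  cu_O4 : forall (u v : nat -> S) (x y : S), increasing u -> increasing v ->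
    is_seq_sup u x -> is_seq_sup v y -> is_seq_sup (fun n => u n + v n) (x + y)
}.

Record cuSemigroup : Type := CuSemigroup {
  cu_poMonoid :> poMonoid;
  cu_axiomsP : cu_axioms cu_poMonoid
}.

Record cu_morphism (S S' : poMonoid) (f : S -> S') : Prop := CuMorphism {
  cu_morph_nmod : nmod_morphism f;
  cu_morph_le : {homo f : x y / x <= y};
  cu_morph_sup : forall (u : nat -> S) z, increasing u ->
    is_seq_sup u z -> is_seq_sup (f \o u) (f z);
  cu_morph_way_below : forall x y : S, way_below x y -> way_below (f x) (f y)
}.

Definition submonoid (V : nmodType) (T : set V) : Prop :=
  GRing.nmod_closed [in T].

(* The closure proof is a parameter so that the monoid structure can be inferred. *)
Definition submonoid_type (V : nmodType) (T : set V) (h : submonoid T) : Type :=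
  set_type T.

HB.instance Definition _ (V : nmodType) (T : set V) (h : submonoid T) :=
  SubChoice.on (submonoid_type h).
HB.instance Definition _ (V : nmodType) (T : set V) (h : submonoid T) :=
  GRing.SubChoice_isSubNmodule.Build V _ (submonoid_type h) h.

Section SubPoMonoid.
Variables (S : poMonoid) (T : set S) (h : submonoid T).

Let le (x y : submonoid_type h) : bool := \val x <= \val y.

Fact sub_pom_le_refl : reflexive le.
Proof. by move=> x; apply: lexx. Qed.

Fact sub_pom_le_anti : antisymmetric le.
Proof. by move=> x y xy; apply/val_inj/le_anti. Qed.

Fact sub_pom_le_trans : transitive le.
Proof. by move=> y x z; apply: le_trans. Qed.

Definition sub_poMonoid : poMonoid :=
  PoMonoid sub_pom_le_refl sub_pom_le_anti sub_pom_le_trans.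

Definition sub_incl (x : sub_poMonoid) : S := \val (x : submonoid_type h).

End SubPoMonoid.

Record sub_cu (S : cuSemigroup) (T : set S) : Prop := SubCu {
  sub_cu_submonoid : submonoid T;
  sub_cu_axioms : cu_axioms (sub_poMonoid sub_cu_submonoid);
  sub_cu_incl : cu_morphism (@sub_incl S T sub_cu_submonoid)
}.

Definition sub_cuSemigroup (S : cuSemigroup) (T : set S) (h : sub_cu T) :
  cuSemigroup := CuSemigroup (sub_cu_axioms h).

Section Properties.
Implicit Types S : cuSemigroup.

(* The default value 0 is never used: the multiples of y increase, so (O1) applies. *)
Definition cu_infty S (y : S) : S :=
  supremum (0%R : S) (range (fun n => (y *+ n)%R : S)).

Definition simple_cu S : Prop :=
  forall x y : S, y <> 0%R -> x <= cu_infty y.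

Definition weakly_cancellative S : Prop :=
  forall x y z : S, way_below (x + z) (y + z) -> way_below x y.

Definition Sub_ctbl S : set (set S) :=
  [set T | exists h : sub_cu T, countably_based (sub_cuSemigroup h)].

(* Directed collections are nonempty. *)
Definition directed S (TT : set (set S)) : Prop :=
  TT !=set0 /\
  forall T1 T2, TT T1 -> TT T2 -> exists2 T, TT T & T1 `<=` T /\ T2 `<=` T.

Definition sigma_complete S (R : set (set S)) : Prop :=
  forall TT : set (set S), TT `<=` R -> countable TT -> directed TT ->
    R (sup_closure (\bigcup_(T in TT) T)).

Definition cofinal S (R : set (set S)) : Prop :=
  forall T0, Sub_ctbl T0 -> exists2 T, R T & T0 `<=` T.

Definition Lowenheim_Skolem (P : cuSemigroup -> Prop) : Prop :=
  forall S, P S -> exists R : set (set S),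
    [/\ R `<=` @Sub_ctbl S, sigma_complete R, cofinal R &
        forall (T : set S) (h : sub_cu T), R T -> P (sub_cuSemigroup h)].

End Properties.

(* Main.v *)
Require Import Defs.
From HB Require Import structures.
From mathcomp Require Import all_boot all_order all_algebra.
From mathcomp Require Import boolp classical_sets cardinality.

(** A sub-Cu-semigroup T of S computes suprema of increasing sequences and the
    way-below relation as S does: suprema are preserved by the inclusion, and
    this alone already makes x << y in S imply x << y in T, while the converse
    is preservation of << by the inclusion.  Simplicity and weak cancellation
    are stated in terms of sums, order, suprema and << only, universally
    quantified over elements, so they restrict from S to T.

    For the Loewenheim-Skolem condition one can therefore take all countably
    based sub-Cu-semigroups, a collection that is trivially cofinal; what has to
    be shown is that it is sigma-complete ([Sub_ctbl_sigma_complete]).  The tool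
    is an intrinsic description of sub-Cu-semigroups ([sub_cuP]): they are the
    submonoids T of S that are closed under suprema of increasing sequences and
    in which every element is the supremum of a sequence in T that is
    <<-increasing in S.  Call elements of the last kind approximable from T.

    If U is the union of a directed family of sub-Cu-semigroups, then every
    element of U is approximable from U.  A diagonal argument
    ([approximable_sup_closed]) shows that the elements approximable from a given
    set are closed under suprema of increasing sequences, so every element of the
    sup-closure of U is approximable from U.  Condition (O4) then makes the
    sup-closure a submonoid, and the description above applies.  Finally, the
    union of countable bases of the members is a basis of the sup-closure: if
    x' << x and x is the supremum of a <<-increasing sequence u in U, then
    x' <= u_n << u_(n+1) << x for some n, and some member of the family contains
    both u_n and u_(n+1), so that its basis has an element between them. *)

Set Implicit Arguments.
Unset Strict Implicit.
Unset Printing Implicit Defensive.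

Import Order.TTheory GRing.Theory.

Local Open Scope classical_set_scope.
Local Open Scope ring_scope.
Local Open Scope order_scope.

(** * Way-below relation and approximable elements *)

Section Poset.
Context {d : Order.disp_t} {P : porderType d}.
Implicit Types (x y z : P) (u v : nat -> P) (T U : set P).

Lemma is_seq_supP u z :
  is_seq_sup u z <->
  (forall n, u n <= z) /\ (forall w, (forall n, u n <= w) -> z <= w).
Proof.
split=> [[ub lub]|[ub lub]].
  split=> [n|w uw]; first by apply: ub; exists n.
  by apply: lub => _ [n _ <-].
by split=> [_ [n _ <-] //|w uw]; apply: lub => n; apply: uw; exists n.
Qed.

Lemma seq_sup_ub u z n : is_seq_sup u z -> u n <= z.
Proof. by move=> /is_seq_supP[]. Qed.

Lemma seq_sup_unique u z z' : is_seq_sup u z -> is_seq_sup u z' -> z = z'.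
Proof.
move=> /is_seq_supP[ub lub] /is_seq_supP[ub' lub'].
by apply/le_anti; rewrite lub // lub'.
Qed.

Lemma way_below_le x y : way_below x y -> x <= y.
Proof.
move=> /(_ (fun=> y) y); case=> //.
by apply/is_seq_supP; split=> // w; apply; exact: 0%N.
Qed.

Lemma way_below_ler x y z : way_below x y -> y <= z -> way_below x z.
Proof. by move=> xy yz u w iu uw zw; apply: (xy u w) => //; apply: le_trans zw. Qed.

Lemma way_below_lel x y z : x <= y -> way_below y z -> way_below x z.
Proof.
move=> xy yz u w iu uw zw; have [n yn] := yz u w iu uw zw.
by exists n; apply: le_trans yn.
Qed.

Lemma way_below_increasing u :
  (forall n, way_below (u n) (u n.+1)) -> increasing u.
Proof.
move=> uS; apply: homo_leq => [x|y x z|n]; [exact: lexx|exact: le_trans|].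
exact: way_below_le.
Qed.

Definition approximable U x : Prop :=
  exists u, [/\ forall n, U (u n), forall n, way_below (u n) (u n.+1)
                & is_seq_sup u x].

(** Countability of the index set is what makes the diagonal argument possible:
    with x n the supremum of u n 0 << u n 1 << ..., one picks indices k n such
    that the elements u n (k n) are <<-increasing and u n (k n) dominates u m n
    for all m <= n; the finitely many conditions on k n are met by a large
    enough index because each u m j is way below x n for m <= n. *)
Lemma approximable_sup_closed U : sup_closed (approximable U).
Proof.
move=> x z incx xz /choice[u uP].
have uU n k : U (u n k) by have [] := uP n.
have uS n k : way_below (u n k) (u n k.+1) by have [] := uP n.
have ux n : is_seq_sup (u n) (x n) by have [] := uP n.
have uinc n : increasing (u n) by apply: way_below_increasing.
have catch m n j : (m <= n)%N -> exists k, u m j <= u n k.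
  move=> mn; apply: (way_below_ler (uS m j) _ (uinc n) (ux n) (lexx _)).
  exact: le_trans (seq_sup_ub _ (ux m)) (incx _ _ mn).
have catch_all n j N : (N <= n.+1)%N ->
    exists k, forall m, (m < N)%N -> u m j <= u n k.
  elim: N => [|N IH] Nn; first by exists 0%N.
  have [k kP] := IH (ltnW Nn); have [l lP] := catch N n j Nn.
  exists (maxn k l) => m; rewrite ltnS leq_eqVlt => /predU1P[->|mN].
    exact: le_trans lP (uinc _ _ _ (leq_maxr _ _)).
  exact: le_trans (kP _ mN) (uinc _ _ _ (leq_maxl _ _)).
(* The next index starts from u n k.+1 rather than u n k: the gap between the two
   is what makes consecutive diagonal elements way below each other. *)
have step (nk : nat * nat) : exists k', way_below (u nk.1 nk.2) (u nk.1.+1 k') /\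
    forall m, (m <= nk.1.+1)%N -> u m nk.1.+1 <= u nk.1.+1 k'.
  case: nk => n k /=; have [k1 k1P] := catch n n.+1 k.+1 (leqnSn n).
  have [k2 k2P] := catch_all n.+1 n.+1 n.+2 (leqnn _).
  exists (maxn k1 k2); split=> [|m mn].
    apply: way_below_ler (uS n k) _; apply: le_trans k1P _.
    exact: uinc (leq_maxl _ _).
  exact: le_trans (k2P m mn) (uinc _ _ _ (leq_maxr _ _)).
have [f fP] := choice step.
pose k := fix k n := if n is n'.+1 then f (n', k n') else 0%N.
have vS n : way_below (u n (k n)) (u n.+1 (k n.+1)) by have [] := fP (n, k n).
have vub m n : (m <= n)%N -> u m n <= u n (k n).
  case: n => [|n]; first by rewrite leqn0 => /eqP->.
  by have [_] := fP (n, k n); apply.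
exists (fun n => u n (k n)); split=> //; apply/is_seq_supP; split=> [n|w vw].
  exact: le_trans (seq_sup_ub _ (ux n)) (seq_sup_ub n xz).
have /is_seq_supP[_] := xz; apply=> m.
have /is_seq_supP[_] := ux m; apply=> j.
apply: le_trans (uinc m _ _ (leq_maxr m j)) _.
by apply: le_trans (vub _ _ (leq_maxl m j)) (vw _).
Qed.

Lemma sup_closure_sub U : U `<=` sup_closure U.
Proof. by move=> x Ux T [_]; apply. Qed.

Lemma sup_closure_closed U : sup_closed (sup_closure U).
Proof.
move=> u z iu uz uU T [Tc UT]; apply: (Tc u) => // n.
by apply: uU.
Qed.

Lemma sup_closure_approximable U :
  U `<=` approximable U -> sup_closure U `<=` approximable U.
Proof. by move=> UA x; apply; split=> //; exact: approximable_sup_closed. Qed.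

Lemma approximable_subset T U : T `<=` U -> approximable T `<=` approximable U.
Proof. by move=> TU x [u [uT uS ux]]; exists u; split=> // n; apply: TU. Qed.

End Poset.

(** * Intrinsic description of sub-Cu-semigroups *)

Lemma cu_leD (S : cuSemigroup) (x y x' y' : S) :
  x <= y -> x' <= y' -> (x + x' : S) <= y + y'.
Proof.
move=> xy xy'; apply: le_trans (cu_leD2r (cu_axiomsP S) x' xy) _.
by rewrite ![y + _]addrC; apply: (cu_leD2r (cu_axiomsP S)).
Qed.

Lemma submonoidP (V : nmodType) (T : set V) :
  submonoid T <-> T 0 /\ forall x y, T x -> T y -> T (x + y)%R.
Proof.
split=> [TM|[T0 TD]].
  have [T0 TD] : GRing.nmod_closed [in T] := TM.
  split=> [|x y Tx Ty]; first exact: set_mem.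
  by apply: set_mem; apply: TD; apply: mem_set.
split=> [|x y xT yT]; first exact: mem_set.
by apply: mem_set; apply: TD; apply: set_mem.
Qed.

Section Submonoid.
Variables (S : cuSemigroup) (T : set S) (h : submonoid T).

Let sT := sub_poMonoid h.
Let incl : sT -> S := @sub_incl S T h.

Definition sub_elt (x : S) (Tx : T x) : sT := exist _ x (mem_set Tx).

Lemma sub_inclP (x : sT) : T (incl x).
Proof. by apply: set_mem; apply: valP. Qed.

Lemma sub_incl_inj : injective incl.
Proof. exact: val_inj. Qed.

Lemma sub_incl_sup_reflect (u : nat -> sT) z :
  is_seq_sup (incl \o u) (incl z) -> is_seq_sup u z.
Proof.
move=> /is_seq_supP[ub lub]; apply/is_seq_supP; split=> [n|w uw].
  exact: ub.
by apply: lub => n; apply: uw.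
Qed.

(** The supremum taken in S belongs to T, hence is a supremum in T as well, and
    suprema in T are unique. *)
Lemma sub_incl_sup_preserve : sup_closed T -> forall (u : nat -> sT) z,
  increasing u -> is_seq_sup u z -> is_seq_sup (incl \o u) (incl z).
Proof.
move=> Tc u z iu uz.
have iv : increasing (incl \o u) by move=> m n /iu.
have [w uw] := cu_O1 (cu_axiomsP S) iv.
have Tw : T w by apply: Tc iv uw _ => n; apply: sub_inclP.
have uw' : is_seq_sup u (sub_elt Tw) by apply: sub_incl_sup_reflect.
by rewrite (seq_sup_unique uz uw').
Qed.

Lemma sub_way_below_reflect (x y : sT) :
    (forall (u : nat -> sT) z, increasing u -> is_seq_sup u z ->
       is_seq_sup (incl \o u) (incl z)) ->
  way_below (incl x) (incl y) -> way_below x y.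
Proof.
move=> pres xy u z iu uz yz.
by apply: (xy (incl \o u) (incl z)) => //; apply: pres.
Qed.

(** Testing x << y in T on a sequence in T that is <<-increasing in S with
    supremum y puts x below a term that is way below y in S. *)
Lemma sub_way_below_preserve (x y : sT) :
  approximable T (incl y) -> way_below x y -> way_below (incl x) (incl y).
Proof.
move=> [u [uT uS uy]] xy.
have [|||n xn] := xy (fun n => sub_elt (uT n)) y.
- by move=> m n /(way_below_increasing uS).
- exact: sub_incl_sup_reflect.
- exact: lexx.
apply: (@way_below_lel _ _ _ (u n)) => //.
exact: way_below_ler (uS n) (seq_sup_ub _ uy).
Qed.

End Submonoid.

Lemma sub_cu_way_below (S : cuSemigroup) (T : set S) (h : sub_cu T)
    (x y : sub_cuSemigroup h) :
  way_below x y <-> way_below (sub_incl x) (sub_incl y).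
Proof.
have [_ _ pres wb] := sub_cu_incl h.
by split; [apply: wb|apply: sub_way_below_reflect].
Qed.

(** For the converse direction, closure under suprema makes suprema in T and in S
    agree, and approximability makes the two way-below relations agree; the
    axioms then transfer from S, approximability being (O2) itself. *)
Lemma sub_cuP (S : cuSemigroup) (T : set S) :
  sub_cu T <-> [/\ submonoid T, sup_closed T & T `<=` approximable T].
Proof.
split=> [h|[h Tc TA]].
  have [_ _ pres wb] := sub_cu_incl h.
  split=> [|u z iu uz uT|x Tx]; first exact: sub_cu_submonoid h.
    pose v n := sub_elt (sub_cu_submonoid h) (uT n).
    have iv : increasing v by move=> m n /iu.
    have [w vw] := cu_O1 (sub_cu_axioms h) iv.
    have -> := seq_sup_unique uz (pres _ _ iv vw); exact: sub_inclP.
  have [u [uS ux]] := cu_O2 (sub_cu_axioms h) (sub_elt _ Tx).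
  exists (@sub_incl _ _ (sub_cu_submonoid h) \o u); split=> [n|n|].
  - exact: sub_inclP.
  - exact: wb.
  - exact: pres (way_below_increasing uS) ux.
have pres := @sub_incl_sup_preserve S T h Tc.
have refl x y := @sub_way_below_reflect S T h x y pres.
have wb x y := @sub_way_below_preserve S T h x y (TA _ (sub_inclP y)).
exists h.
  split.
  - by move=> x; apply: (cu_ge0 (cu_axiomsP S) (sub_incl x)).
  - by move=> x y z xy; apply: (cu_leD2r (cu_axiomsP S) (sub_incl z) xy).
  - move=> u iu.
    have iv : increasing (@sub_incl _ _ h \o u) by move=> m n /iu.
    have [w uw] := cu_O1 (cu_axiomsP S) iv.
    have Tw : T w by apply: Tc iv uw _ => n; apply: sub_inclP.
    by exists (sub_elt h Tw); apply: sub_incl_sup_reflect.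
  - move=> x; have [u [uT uS ux]] := TA _ (sub_inclP x).
    exists (fun n => sub_elt h (uT n)); split=> [n|]; first by apply: refl; exact: uS.
    exact: sub_incl_sup_reflect.
  - by move=> x' x y' y /wb x'x /wb y'y; apply: refl; exact: (cu_O3 (cu_axiomsP S) x'x y'y).
  - move=> u v x y iu iv /(pres _ _ iu) ux /(pres _ _ iv) vy.
    apply: sub_incl_sup_reflect.
    apply: (cu_O4 (cu_axiomsP S) _ _ ux vy); first by move=> m n /iu.
    by move=> m n /iv.
by split.
Qed.

(** * Permanence of simplicity and weak cancellation *)

Lemma is_seq_sup_supremum {d} {P : porderType d} (x0 : P) (u : nat -> P) z :
  is_seq_sup u z -> is_seq_sup u (supremum x0 (range u)).
Proof.
move=> uz; rewrite /supremum; case: ifPn => [/eqP e|_].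
  have : range u (u 0%N) by exists 0%N.
  by rewrite e.
by apply: (xgetPex _ _); exists z.
Qed.

Lemma cu_inftyP (S : cuSemigroup) (y : S) :
  increasing (fun n => y *+ n : S) /\ is_seq_sup (fun n => y *+ n : S) (cu_infty y).
Proof.
have inc : increasing (fun n => y *+ n : S).
  apply: homo_leq => [x|b a c|n]; [exact: lexx|exact: le_trans|].
  rewrite mulrS -{1}[y *+ n]add0r; apply: (cu_leD2r (cu_axiomsP S)).
  exact: (cu_ge0 (cu_axiomsP S)).
split=> //; have [z yz] := cu_O1 (cu_axiomsP S) inc.
exact: is_seq_sup_supremum yz.
Qed.

Lemma sub_cu_simple (S : cuSemigroup) (T : set S) (h : sub_cu T) :
  simple_cu S -> simple_cu (sub_cuSemigroup h).
Proof.
move=> Ssimple x y y0; have [[incl0 inclD] _ pres _] := sub_cu_incl h.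
have y0' : sub_incl y <> 0 by rewrite -incl0 => /sub_incl_inj.
have [iy ysup] := cu_inftyP y.
have inclM n : sub_incl (y *+ n : sub_cuSemigroup h) = sub_incl y *+ n.
  by elim: n => [|n IH]; rewrite ?mulr0n // !mulrS -IH -inclD.
have := pres _ _ iy ysup.
rewrite (_ : _ \o _ = fun n => sub_incl y *+ n); last exact/funext/inclM.
have [_ ysup'] := cu_inftyP (sub_incl y) => /(seq_sup_unique ysup') e.
by have := Ssimple (sub_incl x) (sub_incl y) y0'; rewrite e.
Qed.

Lemma sub_cu_weakly_cancellative (S : cuSemigroup) (T : set S) (h : sub_cu T) :
  weakly_cancellative S -> weakly_cancellative (sub_cuSemigroup h).
Proof.
move=> Swc x y z /sub_cu_way_below xyz; apply/sub_cu_way_below.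
exact: (Swc _ _ (sub_incl z)).
Qed.

(** * Countably based sub-Cu-semigroups *)

(** Bases are described inside S so that bases of different members of a family
    can be united. *)
Lemma sub_cu_countably_basedP (S : cuSemigroup) (T : set S) (h : sub_cu T) :
  countably_based (sub_cuSemigroup h) <->
  exists2 B : set S, countable B & forall x' x, T x' -> T x -> way_below x' x ->
    exists2 y, (B `&` T) y & way_below x' y /\ way_below y x.
Proof.
split=> [[B [cB Bb]]|[B cB Bb]].
  exists (@sub_incl _ _ (sub_cu_submonoid h) @` B).
    exact: sub_countable (card_image_le _ _) cB.
  move=> x' x Tx' Tx x'x.
  have [|y By [x'y yx]] := Bb (sub_elt _ Tx') (sub_elt _ Tx).
    exact/sub_cu_way_below.
  exists (sub_incl y); first by split; [exists y|apply: sub_inclP].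
  by split; [move/sub_cu_way_below: x'y|move/sub_cu_way_below: yx].
exists (@sub_incl _ _ (sub_cu_submonoid h) @^-1` B); split.
  apply: sub_countable (card_ge_preimage _) cB => x y _ _.
  exact: sub_incl_inj.
move=> x' x /sub_cu_way_below x'x.
have [y [By Ty] [x'y yx]] := Bb _ _ (sub_inclP x') (sub_inclP x) x'x.
by exists (sub_elt _ Ty) => //; split; apply/sub_cu_way_below.
Qed.

Section DirectedUnion.
Variables (S : cuSemigroup) (TT : set (set S)).
Hypotheses (TTsub : forall T, TT T -> sub_cu T) (TTdir : directed TT).

Let U : set S := \bigcup_(T in TT) T.

Lemma directed_common_member x y : U x -> U y -> exists2 T, TT T & T x /\ T y.
Proof.
move=> [T1 TT1 T1x] [T2 TT2 T2y]; have [_ dir] := TTdir.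
by have [T TTT [T1T T2T]] := dir _ _ TT1 TT2; exists T => //; split; auto.
Qed.

Lemma directed_union_approximable : U `<=` approximable U.
Proof.
move=> x [T TTT Tx]; have /sub_cuP[_ _ TA] := TTsub TTT.
by apply: (approximable_subset _ (TA _ Tx)) => y Ty; exists T.
Qed.

Lemma sup_closure_union_approximable : sup_closure U `<=` approximable U.
Proof. exact/sup_closure_approximable/directed_union_approximable. Qed.

(** Sums of terms of two approximating sequences stay in the union because the
    family is directed; (O4) passes to the suprema. *)
Lemma sup_closure_union_submonoid : submonoid (sup_closure U).
Proof.
apply/submonoidP; split.
  have [[T TTT] _] := TTdir; have /sub_cuP[/submonoidP[T0 _] _ _] := TTsub TTT.
  by apply: sup_closure_sub; exists T.
move=> x y /sup_closure_union_approximable[u [uU uS ux]].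
move=> /sup_closure_union_approximable[v [vU vS vy]].
have iu := way_below_increasing uS; have iv := way_below_increasing vS.
apply: sup_closure_closed (cu_O4 (cu_axiomsP S) iu iv ux vy) _.
  by move=> m n mn; apply: cu_leD; [apply: iu|apply: iv].
move=> n; apply: sup_closure_sub.
have [T TTT [Tu Tv]] := directed_common_member (uU n) (vU n).
exists T => //; have /sub_cuP[/submonoidP[_ TD] _ _] := TTsub TTT.
exact: TD.
Qed.

Lemma sup_closure_union_sub_cu : sub_cu (sup_closure U).
Proof.
apply/sub_cuP; split; first exact: sup_closure_union_submonoid.
  exact: sup_closure_closed.
apply: subset_trans sup_closure_union_approximable _.
exact: approximable_subset (@sup_closure_sub _ _ U).
Qed.

End DirectedUnion.

Lemma Sub_ctbl_sigma_complete (S : cuSemigroup) : sigma_complete (@Sub_ctbl S).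
Proof.
move=> TT TTS cTT TTdir.
have TTsub T : TT T -> sub_cu T by move=> /TTS[].
exists (sup_closure_union_sub_cu TTsub TTdir); apply/sub_cu_countably_basedP.
have /choice[B BP] : forall T : set S, exists B : set S, TT T -> countable B /\
    forall x' x, T x' -> T x -> way_below x' x ->
      exists2 y, (B `&` T) y & way_below x' y /\ way_below y x.
  move=> T; have [/TTS[h /sub_cu_countably_basedP[B cB Bb]]|nT] := pselect (TT T).
    by exists B.
  by exists set0.
exists (\bigcup_(T in TT) B T).
  by apply: bigcup_countable => // T /BP[].
move=> x' x _ /(sup_closure_union_approximable TTsub)[u [uU uS ux]] x'x.
have [n x'n] := x'x u x (way_below_increasing uS) ux (lexx x).
have [T TTT [Tn TSn]] := directed_common_member TTdir (uU n) (uU n.+1).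
have [_ Bb] := BP T TTT; have [y [By Ty] [ny yn]] := Bb _ _ Tn TSn (uS n).
exists y; first by split; [exists T|apply: sup_closure_sub; exists T].
split; first exact: way_below_lel x'n ny.
exact: way_below_ler yn (seq_sup_ub _ ux).
Qed.

(** A property inherited by all sub-Cu-semigroups is witnessed by the largest
    collection. *)
Lemma hereditary_Lowenheim_Skolem (P : cuSemigroup -> Prop) :
    (forall S : cuSemigroup, P S ->
       forall (T : set S) (h : sub_cu T), P (sub_cuSemigroup h)) ->
  Lowenheim_Skolem P.
Proof.
move=> Pher S PS; exists (@Sub_ctbl S); split=> //.
- exact: Sub_ctbl_sigma_complete.
- by move=> T0 T0S; exists T0.
- by move=> T h _; apply: Pher.
Qed.

Theorem proposition5p4 :
  [/\ forall S : cuSemigroup, simple_cu S ->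
        forall (T : set S) (h : sub_cu T), simple_cu (sub_cuSemigroup h),
      forall S : cuSemigroup, weakly_cancellative S ->
        forall (T : set S) (h : sub_cu T), weakly_cancellative (sub_cuSemigroup h),
      Lowenheim_Skolem simple_cu &
      Lowenheim_Skolem weakly_cancellative].
Proof.
have simple S (Ssimple : simple_cu S) T h := @sub_cu_simple S T h Ssimple.
have canc S (Swc : weakly_cancellative S) T h :=
  @sub_cu_weakly_cancellative S T h Swc.
split=> //; first exact: hereditary_Lowenheim_Skolem simple.
exact: hereditary_Lowenheim_Skolem canc.
Qed.
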